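(* Let $n\ge 1$, let $T$ be a symmetric complex $n\times n$ matrix whose imaginary part $\mathrm{Im}\,T$ is positive definite, let $c\in\mathbb{C}^n$, and let $D$ be a discrete subgroup of $\mathcal{G}=\mathbb{R}^n\times\widehat{\mathbb{R}^n}\cong\mathbb{R}^n\times\mathbb{R}^n$. Let $$f_{T,c}(x_1)=e^{\pi i x_1^tTx_1+2\pi i c^tx_1},\qquad x_1\in\mathbb{R}^n,$$ and define the quantum theta function $\Theta_{D,c}$ by $${}_D\langle f_{T,c},f_{T,c}\rangle=\frac{1}{\sqrt{2^n\det(\mathrm{Im}\,T)}}\,\Theta_{D,c},$$ where ${}_D\langle\cdot,\cdot\rangle$ is the $S(D)$-valued inner product. For $g=(g_1,g_2)\in\mathcal{G}$ write $\underline{g}=Tg_1+g_2$ and $\underline{g}^*=\overline{T}g_1+g_2$. For $g,h\in D$ put $$H_c(\underline g,\underline g)=(\underline g-2i\,\mathrm{Im}\,c)^t(\mathrm{Im}\,T)^{-1}(\underline g^*-2i\,\mathrm{Im}\,c)+4i\,g_1^t(\mathrm{Re}\,c),\qquad C_{g,c}=e^{-\frac{\pi}{2}H_c(\underline g,\underline g)},$$ $$X(\underline g,\underline h)=\underline g^t(\mathrm{Im}\,T)^{-1}\underline h^*+2(\mathrm{Im}\,c)^t(\mathrm{Im}\,T)^{-1}(\mathrm{Im}\,c),$$ and let $x_{g,c}^*$ be the ''quantum translation operator'' defined by $$x_{g,c}^*(e_{D,\alpha}(h))=e^{-\pi X(\underline g,\underline h)}\,e_{D,\alpha}(h)\qquad(h\in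 D).$$ Then for every $g\in D$, $$C_{g,c}\;e_{D,\alpha}(g)\;x_{g,c}^*(\Theta_{D,c})=\Theta_{D,c}.$$
   Context: Elements of $\mathbb{R}^n$ and $\mathbb{C}^n$ are column vectors, $t$ denotes transpose, and $\mathrm{Re}$, $\mathrm{Im}$ and the bar (complex conjugation) are taken entrywise. The dual group of $\mathbb{R}^n$ is identified with $\mathbb{R}^n$, so elements of $\mathcal{G}$ are pairs $x=(x_1,x_2)$ with $x_1,x_2\in\mathbb{R}^n$. For $y=(y_1,y_2)\in\mathcal{G}$, the operator $\pi_y$ on $L^2(\mathbb{R}^n)$ is $$(\pi_{(y_1,y_2)}f)(x_1)=e^{2\pi i x_1^ty_2+\pi i y_1^ty_2}f(x_1+y_1).$$ These operators satisfy $\pi_x\pi_y=\alpha(x,y)\pi_{x+y}$ with cocycle $\alpha(x,y)=e^{\pi i(x_1^ty_2-y_1^tx_2)}$. $S(D)$ is the space of Schwartz (rapidly decaying) functions on $D$. An element $\Phi\in S(D)$ is written $\Phi=\sum_{w\in D}\Phi(w)\,e_{D,\alpha}(w)$, where $e_{D,\alpha}(w)$ is the delta function supported at $w$. Multiplication is the twisted convolution determined by $$e_{D,\alpha}(w_1)\,e_{D,\alpha}(w_2)=\alpha(w_1,w_2)\,e_{D,\alpha}(w_1+w_2).$$ For Schwartz functions $f,g$ on $\mathbb{R}^n$, the $S(D)$-valued inner product is $${}_D\langle f,g\rangle=\sum_{w\in D}\langle f,\pi_wg\rangle\,e_{D,\alpha}(w),\qquad \langle f,p\rangle=\int_{\mathbb{R}^n}f(x_1)\overline{p(x_1)}\,dx_1,$$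 with $dx_1$ Lebesgue measure. The operator $x_{g,c}^*$ and left multiplication by $e_{D,\alpha}(g)$ are applied termwise to sums $\sum_{h\in D}a_h\,e_{D,\alpha}(h)$, that is, $x_{g,c}^*\big(\sum_h a_h e_{D,\alpha}(h)\big)=\sum_h a_h e^{-\pi X(\underline g,\underline h)}e_{D,\alpha}(h)$. The asserted identity is equality of the coefficients of each $e_{D,\alpha}(h)$, $h\in D$. *)

(* Defs.v *)
From HB Require Import structures.
From mathcomp Require Import all_boot all_order all_algebra.
From mathcomp Require Import all_classical all_reals all_analysis.
From mathcomp Require Import complex lra.

Set Implicit Arguments.
Unset Strict Implicit.
Unset Printing Implicit Defensive.
Import Order.TTheory GRing.Theory Num.Theory.
Import numFieldNormedType.Exports.

Local Open Scope classical_set_scope.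
Local Open Scope ring_scope.
Local Open Scope complex_scope.

Section lebesgue_tuple.
Context (R : realType).
Let mR := measurableTypeR R.

Definition cons_pair n (p : mR * n.-tuple mR) : n.+1.-tuple mR :=
  [tuple of p.1 :: p.2].

Lemma measurable_cons_pair n : measurable_fun setT (@cons_pair n).
Proof. exact: measurable_cons. Qed.

Section step.
Context n (mu : {sigma_finite_measure set (n.-tuple mR) -> \bar R}).

Definition lebesgue_step : set (n.+1.-tuple mR) -> \bar R :=
  pushforward (@lebesgue_measure R \x mu)%E (@cons_pair n).

Let step_measure : {measure set (n.+1.-tuple mR) -> \bar R} :=
  measure_function_pushforward__canonical__measure_function_Measure
    (@lebesgue_measure R \x mu)%E (@measurable_cons_pair n).

HB.instance Definition _ := isMeasure.Build _ _ _ lebesgue_step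
  (@measure0 _ _ _ step_measure) (@measure_ge0 _ _ _ step_measure)
  (@measure_semi_sigma_additive _ _ _ step_measure).

Let sigma_finite_lebesgue_step : sigma_finite setT lebesgue_step.
Proof.
have /sigma_finiteP[F [TF ndF Foo]] := sigma_finiteT (@lebesgue_measure R).
have /sigma_finiteP[G [TG ndG Goo]] := sigma_finiteT mu.
pose tl (t : n.+1.-tuple mR) : mR * n.-tuple mR :=
  (thead t, [tuple of behead t]).
have mtl : measurable_fun setT tl.
  by apply/measurable_fun_pair => /=;
    [exact: measurable_tnth|exact: measurable_behead].
have consK : cancel (@cons_pair n) tl.
  by move=> [x t]; rewrite /tl/= theadE; congr pair; apply/val_inj.
exists (fun i => tl @^-1` (F i `*` G i)).
  rewrite -preimage_bigcup -[LHS](preimage_setT tl); congr preimage.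
  apply/esym; rewrite -subTset => -[x t] _.
  have [i _ Fix] : (\bigcup_i F i) x by rewrite -TF.
  have [j _ Gjt] : (\bigcup_j G j) t by rewrite -TG.
  exists (maxn i j) => //; split.
    by move: x Fix; exact/subsetPset/ndF/leq_maxl.
  by move: t Gjt; exact/subsetPset/ndG/leq_maxr.
move=> i; have [mFi Fioo] := Foo i; have [mGi Gioo] := Goo i; split.
  by rewrite -[X in measurable X]setTI; apply: mtl => //; exact: measurableX.
rewrite /lebesgue_step /pushforward -comp_preimage.
rewrite (_ : tl \o _ = id); last by apply/funext => p /=; rewrite consK.
by rewrite preimage_id product_measure1E// lte_mul_pinfty// ge0_fin_numE.
Qed.

HB.instance Definition _ :=
  Measure_isSigmaFinite.Build _ _ _ lebesgue_step sigma_finite_lebesgue_step.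

End step.

(* n-dimensional Lebesgue measure, on n-tuples of reals, as the iterated
   product measure; it is the one of lebesgue_tuple_box. *)
Fixpoint lebesgue_tuple n : {sigma_finite_measure set (n.-tuple mR) -> \bar R} :=
  match n with
  | 0 => \d_([tuple] : 0.-tuple mR)
  | m.+1 => lebesgue_step (lebesgue_tuple m)
  end.

Lemma lebesgue_tuple_box n (A : 'I_n -> set mR) :
  (forall i, measurable (A i)) ->
  lebesgue_tuple n [set t | forall i, A i (tnth t i)] =
  (\prod_(i < n) lebesgue_measure (A i))%E.
Proof.
elim: n A => [|n IHn] A mA.
  by rewrite big_ord0 /= diracE mem_set//= => -[].
rewrite big_ord_recl -IHn//= /lebesgue_step /pushforward.
rewrite -product_measure1E//; last first.
  rewrite (_ : mkset _ = \bigcap_(i in [set: 'I_n])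
    ((fun t : n.-tuple mR => tnth t i) @^-1` A (lift ord0 i))); last first.
    by apply/seteqP; split=> t /= h i; [move=> _; exact: h|exact: h].
  apply: fin_bigcap_measurable => // i _.
  by rewrite -[X in measurable X]setTI; exact: measurable_tnth.
congr product_measure1; apply/seteqP; split=> -[x t] /=.
  move=> h; split=> [|i]; first exact: (h ord0).
  by have := h (lift ord0 i); rewrite tnthS.
by move=> [hx ht] i; case: (unliftP ord0 i) => [j|] ->; rewrite ?tnthS.
Qed.

End lebesgue_tuple.

Section complex_analysis.
Context (R : realType).

Definition cexp (z : R[i]) : R[i] :=
  (expR (complex.Re z))%:C * (cos (complex.Im z) +i* sin (complex.Im z)).

(* Unordered sums over an arbitrary index set, as positive minus negative part;
   meaningful when the family is absolutely summable. *)
Definition rsum (I : choiceType) (D : set I) (F : I -> R) : R :=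
  fine (\esum_(w in D) (Num.max (F w) 0)%:E) -
  fine (\esum_(w in D) (Num.max (- F w) 0)%:E).

Definition csum (I : choiceType) (D : set I) (F : I -> R[i]) : R[i] :=
  rsum D (fun w => complex.Re (F w)) +i* rsum D (fun w => complex.Im (F w)).

Lemma csum1 (I : choiceType) (D : set I) (F : I -> R[i]) (g : I) :
  D g -> (forall w, D w -> w != g -> F w = 0) -> csum D F = F g.
Proof.
move=> Dg F0.
have esum1g (a : I -> R) : (forall w, 0 <= a w) ->
    (forall w, D w -> w != g -> a w = 0) -> \esum_(w in D) (a w)%:E = (a g)%:E.
  move=> a0 ag.
  transitivity (\esum_(w in D `&` [set g]) (a w)%:E).
    rewrite esum_mkcondr; apply: eq_esum => w Dw; case: ifPn => //.
    by move=> wg; rewrite ag//; apply: contraNneq wg => ->; rewrite inE.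
  rewrite (_ : D `&` [set g] = [set g]); last by apply: setIidr => _ ->.
  by rewrite esum_set1// lee_fin.
have rsum1 (G : I -> R) :
    (forall w, D w -> w != g -> G w = 0) -> rsum D G = G g.
  move=> G0; rewrite /rsum !esum1g ?lexx//=.
  - by case: (lerP (G g) 0) => h; case: (lerP (- G g) 0) => h';
      rewrite ?subr0 ?sub0r ?opprK//; lra.
  - by move=> w; rewrite le_max lexx orbT.
  - by move=> w Dw wg; rewrite G0// oppr0 maxxx.
  - by move=> w; rewrite le_max lexx orbT.
  - by move=> w Dw wg; rewrite G0// maxxx.
rewrite /csum !rsum1; first by case: (F g).
- by move=> w Dw wg; rewrite F0.
- by move=> w Dw wg; rewrite F0.
Qed.

Definition integral_Rn n (F : 'cV[R]_n -> R[i]) : R[i] :=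
  (\int[lebesgue_tuple R n]_t complex.Re (F (\col_i tnth t i))) +i*
  (\int[lebesgue_tuple R n]_t complex.Im (F (\col_i tnth t i))).

Definition inner_L2 n (f p : 'cV[R]_n -> R[i]) : R[i] :=
  integral_Rn (fun x => f x * conjc (p x)).

End complex_analysis.

(* Phase space: R^n x (dual of R^n), the dual being identified with R^n. *)
Notation phase R n := ('cV[R]_n * 'cV[R]_n)%type.

Definition dotmx (K : pzRingType) n (u v : 'cV[K]_n) : K := (u^T *m v) 0 0.

Definition cplxmx (R : realType) m n : 'M[R]_(m, n) -> 'M[R[i]]_(m, n) :=
  map_mx (real_complex R).
Definition remx (R : realType) m n : 'M[R[i]]_(m, n) -> 'M[R]_(m, n) :=
  map_mx (@complex.Re R).
Definition immx (R : realType) m n : 'M[R[i]]_(m, n) -> 'M[R]_(m, n) :=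
  map_mx (@complex.Im R).
Definition conjmx (R : realType) m n : 'M[R[i]]_(m, n) -> 'M[R[i]]_(m, n) :=
  map_mx (@conjc R).

Definition posdefmx (R : realType) n (Y : 'M[R]_n) : Prop :=
  forall x : 'cV[R]_n, x != 0 -> 0 < dotmx x (Y *m x).

Definition discrete_subgroup (R : realType) n (D : set (phase R n)) : Prop :=
  [/\ D 0, forall x y, D x -> D y -> D (x - y) & D `<=` isolated D].

Section twisted_group_algebra.
Context (R : realType) (n : nat).
Implicit Types (x y g h w : phase R n) (D : set (phase R n)).

Definition heis y (f : 'cV[R]_n -> R[i]) : 'cV[R]_n -> R[i] := fun x1 : 'cV[R]_n =>
  cexp ((2 * pi * dotmx x1 y.2 + pi * dotmx y.1 y.2)%:C * 'i) * f (x1 + y.1).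

Definition cocycle x y : R[i] :=
  cexp ((pi * (dotmx x.1 y.2 - dotmx y.1 x.2))%:C * 'i).

(* A formal sum \sum_(w in D) Phi(w) e_{D,alpha}(w), and in particular an
   element of S(D), is represented by its coefficient function, extended by 0
   outside of D. No decay is imposed on coefficient functions: quantum
   translations do not preserve rapid decay. *)
Definition delta g : phase R n -> R[i] := fun w => (w == g)%:R.

(* Coefficient at h of the product Phi Psi: the term e(w) e(w') contributes
   exactly when w' = h - w. *)
Definition tconv D (Phi Psi : phase R n -> R[i]) : phase R n -> R[i] :=
  fun h => csum D (fun w => cocycle w (h - w) * (Phi w * Psi (h - w))).

(* Left multiplication by e(g) acts termwise: its coefficient at h comes from
   the term of Psi at h - g, without any convergence condition on Psi. *)
Lemma tconv_deltal D g Psi h : D g ->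
  tconv D (delta g) Psi h = cocycle g (h - g) * Psi (h - g).
Proof.
move=> Dg; rewrite /tconv (csum1 Dg); first by rewrite /delta eqxx mul1r.
by move=> w _ /negbTE wg; rewrite /delta wg mul0r mulr0.
Qed.

Definition inner_D D (f p : 'cV[R]_n -> R[i]) : phase R n -> R[i] :=
  fun w => if w \in D then inner_L2 f (heis w p) else 0.

End twisted_group_algebra.

Section quantum_theta.
Context (R : realType) (n : nat) (T : 'M[R[i]]_n) (c : 'cV[R[i]]_n).
Implicit Types g h : phase R n.

Definition gaussT (x1 : 'cV[R]_n) : R[i] :=
  let x := cplxmx x1 in
  cexp (pi%:C * 'i * dotmx x (T *m x) + 2 * pi%:C * 'i * dotmx c x).

(* The vectors written with an underline: T g_1 + g_2 and its starred form. *)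
Definition uline g : 'cV[R[i]]_n := T *m cplxmx g.1 + cplxmx g.2.
Definition uline_star g : 'cV[R[i]]_n := conjmx T *m cplxmx g.1 + cplxmx g.2.

Definition im_inv : 'M[R[i]]_n := cplxmx (invmx (immx T)).

Definition Hc g : R[i] :=
  let a := (2 * 'i) *: cplxmx (immx c) in
  dotmx (uline g - a) (im_inv *m (uline_star g - a)) +
  4 * 'i * dotmx (cplxmx g.1) (cplxmx (remx c)).

Definition Cgc g : R[i] := cexp (- (pi / 2)%:C * Hc g).

Definition Xgh g h : R[i] :=
  dotmx (uline g) (im_inv *m uline_star h) +
  2 * dotmx (cplxmx (immx c)) (im_inv *m cplxmx (immx c)).

Definition qtrans g (Phi : phase R n -> R[i]) : phase R n -> R[i] :=
  fun h => cexp (- pi%:C * Xgh g h) * Phi h.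

(* Determines Theta uniquely, since \det (immx T) > 0. *)
Definition is_quantum_theta (D : set (phase R n)) (Theta : phase R n -> R[i]) :=
  forall w, inner_D D gaussT gaussT w =
    ((Num.sqrt (2 ^+ n * \det (immx T)))^-1)%:C * Theta w.

End quantum_theta.

(* Main.v *)
Require Import Defs.
From mathcomp Require Import all_boot all_order all_algebra.
From mathcomp Require Import all_classical all_reals all_analysis.
From mathcomp Require Import measurable_realfun lebesgue_integral_under complex.
From mathcomp Require Import ring lra.

Set Implicit Arguments.
Unset Strict Implicit.
Unset Printing Implicit Defensive.
Import Order.TTheory GRing.Theory Num.Theory.
Import numFieldNormedType.Exports.

Local Open Scope classical_set_scope.
Local Open Scope ring_scope.

(* The unqualified names denote operations of sesquilinear algebra here. *)
Local Notation dotmx := Defs.dotmx.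
Local Notation conjmx := Defs.conjmx.

(** Both sides are explicit Gaussians.  The function Theta is computed first:
    completing the square in the overlap of f_{T,c} with its translate by w
    splits off the constant factor C_{w,c} and leaves the integral of
    exp (- 2 pi (x + s)^t (Im T) (x + s)) over R^n, where s is a complex vector
    depending on w ([gaussT_inner_integrand]).  That integral is independent of
    s and equal to (2^n det (Im T))^(-1/2) ([cintegral_gauss]); hence
    Theta(w) = C_{w,c} for every w in D ([quantum_thetaE]).  The functional
    equation then says that w |-> C_{w,c} satisfies
      C_g alpha(g,k) exp (- pi X(g,k)) C_k = C_{g+k}
    at k = h - g ([Cgc_cocycle]).  This is an identity between exponents: the
    symmetric part of X cancels the cross terms of H, and the antisymmetric
    part that is left over cancels the exponent of the cocycle.

    The integral is independent of s for the following reasons.  On the line,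
    z |-> exp (- a z^2) is holomorphic, so the derivative of its integral
    along a horizontal line with respect to the height of the line is i times
    the integral of a derivative along the line, which vanishes because of the
    decay at infinity ([Rintegral_gauss_wave]); at height zero the value is the
    total mass of a normal density.  In dimension n + 1, the Schur complement
    of the upper left entry writes the quadratic form as one square, whose
    centre depends on the other variables, plus a form in these variables
    ([qform_schur]).  The inner integral over the first variable does not see
    the centre of the square, and it remains to apply Fubini and induction. *)

(** * The Gaussian integral on the line, with a complex centre *)

Section gauss_line.
Context (R : realType).
Implicit Types (a al be p q Q u x : R).
Let mu := @lebesgue_measure R.

(** Integrate over the intervals [-n, n] with the fundamental theorem of
    calculus, and let n tend to infinity under the integral. *)
Lemma Rintegral_derive_eq0 (F f : R -> R) :
    (forall x : R, is_derive x (1:R) F (f x)) -> continuous f ->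
    mu.-integrable setT (EFin \o f) ->
    F n%:R @[n --> \oo] --> (0:R) -> F (- n%:R) @[n --> \oo] --> (0:R) ->
  \int[mu]_x f x = 0.
Proof.
move=> dF cf intf Fy FNy.
pose f_ (n : nat) := (EFin \o f) \_ `[(- n%:R : R), n%:R].
have mf : measurable_fun setT f.
  by apply/measurable_EFinP; exact: (measurable_int mu intf).
have [|||||_ _ cvgI] := @dominated_convergence _ _ R mu setT measurableT f_
  (fun x => (f x)%:E) (fun x => `|(f x)%:E|%E).
- move=> n; apply/(measurable_restrictT _ _).1 => //; apply: measurable_funTS.
  exact/measurable_EFinP.
- exact/measurable_EFinP.
- apply: aeW => x _; apply: cvg_near_cst; near=> n.
  rewrite /f_ patchE ifT// inE/= in_itv/= -ler_norml.
  by near: n; exact: nbhs_infty_ger.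
- exact: (integrable_abse intf).
- apply: aeW => x n _ /=; rewrite /f_ patchE; case: ifP => //= _.
  by rewrite normr0 lee_fin.
have cdF (x : R) : {for x, continuous F}.
  by apply/differentiable_continuous/derivable1_diffP; case: (dF x).
have IE (n : nat) : (\int[mu]_x f_ n.+1 x = (F n.+1%:R - F (- n.+1%:R))%:E)%E.
  rewrite /f_ -integral_mkcond.
  rewrite (@continuous_FTC2 _ f F) ?EFinB//.
  - by rewrite (@lt_trans _ _ 0)// oppr_lt0.
  - exact: continuous_subspaceT.
  - split.
    + by move=> x _; case: (dF x).
    + apply: cvg_at_right_filter; exact: cdF.
    + apply: cvg_at_left_filter; exact: cdF.
  - by move=> x _; rewrite derive1E; case: (dF x).
have cvg0 : (\int[mu]_x f_ n x)%E @[n --> \oo] --> (0%E : \bar R).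
  rewrite -cvg_shiftS /=; under eq_fun do rewrite IE.
  have /= := cvgB Fy FNy; rewrite subr0 -cvg_shiftS /= => FB.
  by apply: cvg_EFin; [near=> n|exact: FB].
by rewrite /Rintegral (cvg_unique (@ereal_hausdorff R) cvgI cvg0).
Unshelve. all: by end_near. Qed.

(** The total mass of the normal density of mean -p and variance 1 / (2 a). *)
Lemma ge0_integral_gauss a p : 0 < a ->
  (\int[mu]_x (expR (- a * (x + p) ^+ 2))%:E)%E = (Num.sqrt (pi / a))%:E.
Proof.
move=> a0.
have s0 : 0 < 2 * a by rewrite mulr_gt0.
have sq0 : (Num.sqrt (2 * a))^-1 != 0 by rewrite invr_eq0 gt_eqF// sqrtr_gt0.
have sE : (Num.sqrt (2 * a))^-1 ^+ 2 = (2 * a)^-1.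
  by rewrite exprVn sqr_sqrtr// ltW.
have := integral_normal_pdf (- p) (Num.sqrt (2 * a))^-1.
have ? := normal_peak_gt0 sq0.
rewrite normal_pdfE// => E.
have {}E : (\int[mu]_x ((normal_peak (Num.sqrt (2 * a))^-1)%:E *
    (expR (- a * (x + p) ^+ 2))%:E) = 1)%E.
  rewrite -[RHS]E; apply: eq_integral => x _; rewrite -EFinM; congr (_ * expR _)%:E.
  by rewrite opprK sE; field; rewrite gt_eqF.
move: E; rewrite ge0_integralZl_EFin//; last 2 first.
- apply/measurable_EFinP; apply: measurableT_comp => //; apply: measurable_funM => //.
  by apply: measurable_funX; apply: measurable_funD.
- exact: ltW.
move=> /(congr1 (fun z => (normal_peak (Num.sqrt (2 * a))^-1)^-1%:E * z)%E).
rewrite muleA -EFinM mulVf ?gt_eqF// mul1e mule1 => ->.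
rewrite /normal_peak invrK sE; congr (Num.sqrt _)%:E.
by field; rewrite gt_eqF.
Qed.

Lemma integrable_gauss_bound a p C (f : R -> R) : 0 < a ->
  measurable_fun setT f ->
  (forall x, `|f x| <= C * expR (- a * (x + p) ^+ 2)) ->
  mu.-integrable setT (EFin \o f).
Proof.
move=> a0 mf fC.
have mg : measurable_fun setT (fun x => expR (- a * (x + p) ^+ 2)).
  apply: measurableT_comp => //; apply: measurable_funM => //.
  by apply: measurable_funX; apply: measurable_funD.
apply: (@le_integrable _ _ _ mu _ measurableT _
  (fun x => (C%:E * (expR (- a * (x + p) ^+ 2))%:E)%E)).
- exact/measurable_EFinP.
- by move=> x _ /=; rewrite lee_fin (le_trans (fC x))// ler_norm.
- apply: integrableZl => //; apply/integrableP; split; first exact/measurable_EFinP.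
  under eq_integral do rewrite gee0_abs ?lee_fin ?expR_ge0//.
  by rewrite ge0_integral_gauss// ltry.
Qed.

(** The real part of (al + i be) exp (- a (u + i q)^2).  With both coefficients
    free, one family contains the real and the imaginary part of the Gaussian
    and, up to the factors q and u, is closed under the two partial
    derivatives: multiplication by i maps (al, be) to (- be, al). *)
Definition gauss_wave a al be q u : R :=
  expR (a * (q ^+ 2 - u ^+ 2)) *
  (al * cos (2 * a * q * u) + be * sin (2 * a * q * u)).

Lemma is_derive_gauss_wave_im a al be u q :
  is_derive q (1:R) (fun q => gauss_wave a al be q u)
    (2 * a * (q * gauss_wave a al be q u + u * gauss_wave a be (- al) q u)).
Proof.
by rewrite /gauss_wave; apply: is_derive_eq; rewrite /GRing.scale/=; ring.
Qed.

Lemma is_derive_gauss_wave_re a al be q u p :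
  is_derive u (1:R) (fun u => gauss_wave a al be q (u + p))
    (2 * a * (q * gauss_wave a be (- al) q (u + p) -
              (u + p) * gauss_wave a al be q (u + p))).
Proof.
by rewrite /gauss_wave; apply: is_derive_eq; rewrite /GRing.scale/=; ring.
Qed.

Lemma gauss_wave_le a al be q Q u : 0 < a -> `|q| <= Q ->
  `|gauss_wave a al be q u| <=
    (`|al| + `|be|) * expR (a * Q ^+ 2) * expR (- a * u ^+ 2).
Proof.
move=> a0 qQ; rewrite /gauss_wave normrM (ger0_norm (expR_ge0 _)) mulrC -[in leRHS]mulrA.
apply: ler_pM => //.
  rewrite (le_trans (ler_normD _ _))// !normrM lerD// ler_piMr//.
    by rewrite ler_norml cos_geN1 cos_le1.
  by rewrite ler_norml sin_geN1 sin_le1.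
rewrite -expRD ler_expR mulrBr mulNr lerD2r ler_pM2l//.
by rewrite -(ger0_norm (sqr_ge0 q)) normrX lerXn2r ?nnegrE// (le_trans _ qQ).
Qed.

(** A linear factor costs half of the rate of decay: the half that is given up
    is compared with 1 + y <= exp y. *)
Lemma expR_gauss_linear a u : 0 < a ->
  `|u| * expR (- a * u ^+ 2) <= (1 + 2 / a) * expR (- (a / 2) * u ^+ 2).
Proof.
move=> a0.
have -> : - a * u ^+ 2 = - (a / 2) * u ^+ 2 + - (a / 2) * u ^+ 2 by field.
rewrite expRD mulrA ler_wpM2r ?expR_ge0//.
rewrite mulNr expRN ler_pdivrMr ?expR_gt0//.
have a20 : 0 < 2 / a by rewrite divr_gt0.
apply: (@le_trans _ _ ((1 + 2 / a) * (1 + a / 2 * u ^+ 2))); last first.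
  by rewrite ler_wpM2l ?expR_ge1Dx// addr_ge0// ltW.
have -> : (1 + 2 / a) * (1 + a / 2 * u ^+ 2) = 1 + 2 / a + a / 2 * u ^+ 2 + u ^+ 2.
  by field; rewrite gt_eqF.
have : 0 <= a / 2 * u ^+ 2 by rewrite mulr_ge0 ?sqr_ge0// divr_ge0// ltW.
rewrite -(real_normK (num_real u)); have := sqr_ge0 (`|u| - 1).
rewrite sqrrB1; have := normr_ge0 u.
move: (`|u|) (2 / a) a20 (_ * _ ^+ 2); move=> {u} u b b0 c; nra.
Qed.

Lemma measurable_gauss_wave a al be q p :
  measurable_fun setT (fun x => gauss_wave a al be q (x + p)).
Proof.
apply: continuous_measurable_fun => x; apply: differentiable_continuous.
by apply/derivable1_diffP; case: (is_derive_gauss_wave_re a al be q x p).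
Qed.

Lemma integrable_gauss_wave a al be q p : 0 < a ->
  mu.-integrable setT (EFin \o (fun x => gauss_wave a al be q (x + p))).
Proof.
move=> a0; apply: (@integrable_gauss_bound a p
  ((`|al| + `|be|) * expR (a * `|q| ^+ 2))) => //.
  exact: measurable_gauss_wave.
by move=> x; exact: gauss_wave_le.
Qed.

(** Domination of the derivative in q, uniformly for q in a bounded interval. *)
Lemma gauss_wave_moment_le a al be q Q u : 0 < a -> `|q| <= Q ->
  `|2 * a * (q * gauss_wave a al be q u + u * gauss_wave a be (- al) q u)| <=
    2 * a * ((`|al| + `|be|) * expR (a * Q ^+ 2)) * (Q + 1 + 2 / a) *
      expR (- (a / 2) * u ^+ 2).
Proof.
move=> a0 qQ; have Q0 : 0 <= Q by rewrite (le_trans _ qQ).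
set K := (_ + _) * expR _; have K0 : 0 <= K by rewrite mulr_ge0 ?expR_ge0.
set E := expR _.
have -> : 2 * a * K * (Q + 1 + 2 / a) * E =
  2 * a * (Q * (K * E) + K * ((1 + 2 / a) * E)) by ring.
rewrite normrM gtr0_norm ?mulr_gt0// ler_pM2l ?mulr_gt0//.
rewrite (le_trans (ler_normD _ _))// [`|q * _|]normrM [`|u * _|]normrM.
have W1 := gauss_wave_le al be u a0 qQ.
have := gauss_wave_le be (- al) u a0 qQ; rewrite normrN [`|be| + _]addrC => W2.
rewrite -/K in W1 W2; rewrite lerD//.
  apply: ler_pM => //; apply: le_trans W1 _; rewrite ler_wpM2l// ler_expR.
  by rewrite ler_wpM2r ?sqr_ge0//; lra.
rewrite (le_trans (ler_wpM2l _ W2))// mulrCA ler_wpM2l//.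
exact: expR_gauss_linear.
Qed.

Lemma cvg_gauss_wave a al be q p (y : R^nat) :
    0 < a -> (forall n, n%:R <= `|y n|) ->
  gauss_wave a al be q (y n + p) @[n --> \oo] --> (0:R).
Proof.
move=> a0 yn; set K := (`|al| + `|be|) * expR (a * `|q| ^+ 2).
apply: norm_cvg0.
(* The bound is (y n + p) ^ 2 >= 2 |y n + p| - 1 >= 2 n - 2 |p| - 1, which
   makes the Gaussian factor at most geometric. *)
apply: (@squeeze_cvgr _ _ _ _ (cst 0)
  (fun n => K * expR (a + 2 * a * `|p|) * expR (- (2 * a)) ^+ n)).
- near=> n => /=; rewrite normr_ge0/= (le_trans (gauss_wave_le al be _ a0 (lexx _)))//.
  rewrite -/K -mulrA ler_wpM2l ?mulr_ge0 ?expR_ge0//.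
  rewrite -expRM_natl -expRD ler_expR.
  have := yn n; have : `|y n| <= `|y n + p| + `|p|.
    by rewrite -[in leLHS](addrK p (y n)) ler_normB.
  rewrite -(real_normK (num_real (y n + p))) -mulr_natl.
  move: (`|y n + p|) (`|y n|) (`|p|) (n%:R) => r s t m h1 h2.
  have := sqr_ge0 (r - 1); nra.
- exact: cvg_cst.
- rewrite -[X in _ --> X](mulr0 (K * expR (a + 2 * a * `|p|))).
  apply: cvgMr; apply: cvg_expr.
  by rewrite ger0_norm ?expR_ge0// expR_lt1 oppr_lt0 mulr_gt0.
Unshelve. all: by end_near. Qed.

(** Contour shift.  The derivative of the integral in q may be taken under the
    integral sign; by the Cauchy-Riemann equation it is the integral of the
    x-derivative of the wave with coefficients (- be, al), hence zero.  At
    q = 0 the wave is a real Gaussian. *)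
Lemma Rintegral_gauss_wave a al be q p : 0 < a ->
  \int[mu]_x gauss_wave a al be q (x + p) = al * Num.sqrt (pi / a).
Proof.
move=> a0.
pose J q := \int[mu]_x gauss_wave a al be q (x + p).
have dW (r : R) : mu.-integrable setT (EFin \o
    (fun x => 2 * a * (r * gauss_wave a al be r (x + p) +
                       (x + p) * gauss_wave a be (- al) r (x + p)))).
  apply: integrable_gauss_bound; last by move=> x; exact: gauss_wave_moment_le.
    by rewrite divr_gt0.
  apply: measurable_funM => //; apply: measurable_funD.
    by apply: measurable_funM => //; exact: measurable_gauss_wave.
  apply: measurable_funM => //; [exact: measurable_funD|exact: measurable_gauss_wave].
have dJ (r : R) : is_derive r (1:R) J 0.
  have I r' : `]r - 1, r + 1[%classic r' -> `|r'| <= `|r| + 1.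
    rewrite /= in_itv/= => /andP[r1 r2]; rewrite ler_norml.
    have := ler_norm r; have := ler_norm (- r); rewrite normrN; lra.
  have hr : `]r - 1, r + 1[%classic r by rewrite /= in_itv/=; apply/andP; split; lra.
  have d1 r' x : partial1of2 (fun q x => gauss_wave a al be q (x + p)) r' x =
      2 * a * (r' * gauss_wave a al be r' (x + p) +
               (x + p) * gauss_wave a be (- al) r' (x + p)).
    by rewrite partial1of2E; case: (is_derive_gauss_wave_im a al be (x + p) r').
  pose C := 2 * a * ((`|al| + `|be|) * expR (a * (`|r| + 1) ^+ 2)) *
    ((`|r| + 1) + 1 + 2 / a).
  have C0 : 0 <= C.
    by rewrite /C !(mulr_ge0, addr_ge0, expR_ge0, invr_ge0)// ?ltW// divr_ge0// ltW.
  have derive_J := @differentiation_under_integral R _ _ mu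
    (fun q x => gauss_wave a al be q (x + p)) setT measurableT r (r - 1) (r + 1) hr.
  have derivable_J := @derivable_under_integral R _ _ mu
    (fun q x => gauss_wave a al be q (x + p)) setT measurableT r (r - 1) (r + 1) hr.
  pose G x := C * expR (- (a / 2) * (x + p) ^+ 2).
  have intW r' : `]r - 1, r + 1[%classic r' ->
      mu.-integrable setT (EFin \o (fun x => gauss_wave a al be r' (x + p))).
    by move=> _; exact: integrable_gauss_wave.
  have derW r' x : `]r - 1, r + 1[%classic r' -> setT x ->
      derivable (fun q => gauss_wave a al be q (x + p)) r' 1.
    by move=> _ _; case: (is_derive_gauss_wave_im a al be (x + p) r').
  have G0 x : 0 <= G x by rewrite mulr_ge0 ?expR_ge0.
  have intG : mu.-integrable setT (EFin \o G).
    apply: (@integrable_gauss_bound (a / 2) p C); first by rewrite divr_gt0.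
      apply: measurable_funM => //; apply: measurableT_comp => //.
      apply: measurable_funM => //; apply: measurable_funX.
      exact: measurable_funD.
    by move=> x; rewrite ger0_norm.
  have GW r' x : `]r - 1, r + 1[%classic r' -> setT x ->
      `|partial1of2 (fun q x => gauss_wave a al be q (x + p)) r' x| <= G x.
    by move=> /I r'Q _; rewrite d1; exact: gauss_wave_moment_le.
  apply: DeriveDef; first exact: (derivable_J intW derW G G0 intG GW).
  rewrite -derive1E (derive_J intW derW G G0 intG GW).
  under eq_Rintegral do rewrite d1.
  apply: (@Rintegral_derive_eq0 (fun x => gauss_wave a (- be) al r (x + p))).
  - move=> x; apply: (is_derive_eq (is_derive_gauss_wave_re a (- be) al r x p)).
    by rewrite /gauss_wave; ring.
  - move=> x.
    have cW al' be' : {for x, continuous (fun x => gauss_wave a al' be' r (x + p))}.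
      apply: differentiable_continuous.
      by apply/derivable1_diffP; case: (is_derive_gauss_wave_re a al' be' r x p).
    apply: cvgM; first exact: cvg_cst.
    apply: cvgD; first by apply: cvgM; [exact: cvg_cst|exact: cW].
    apply: cvgM; last exact: cW.
    by apply: cvgD; [exact: cvg_id|exact: cvg_cst].
  - exact: dW.
  - by apply: cvg_gauss_wave => // n; rewrite normr_nat.
  - by apply: cvg_gauss_wave => // n; rewrite normrN normr_nat.
rewrite -/(J q) (is_derive_0_is_cst q 0 dJ) /J.
have W0 x : gauss_wave a al be 0 (x + p) = al * expR (- a * (x + p) ^+ 2).
  rewrite /gauss_wave mulr0 mul0r cos0 sin0 mulr1 mulr0 addr0 mulrC.
  by congr (_ * expR _); ring.
under eq_Rintegral do rewrite W0.
rewrite RintegralZl//; first by rewrite /Rintegral ge0_integral_gauss.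
apply: (@integrable_gauss_bound a p 1) => //.
  apply: measurableT_comp => //; apply: measurable_funM => //.
  by apply: measurable_funX; exact: measurable_funD.
by move=> x; rewrite ger0_norm ?expR_ge0// mul1r.
Qed.
End gauss_line.

(** * Complex exponentials and integrals of complex functions *)

Section complex_exp.
Local Open Scope complex_scope.
Context (R : realType).
Implicit Types z w : R[i].
Local Notation Re := (@complex.Re R).
Local Notation Im := (@complex.Im R).

Lemma ReM z w : Re (z * w) = Re z * Re w - Im z * Im w.
Proof. by case: z w => [? ?] [? ?]. Qed.

Lemma ImM z w : Im (z * w) = Re z * Im w + Im z * Re w.
Proof. by case: z w => [? ?] [? ?]. Qed.

Lemma Re_cexp z : Re (cexp z) = expR (Re z) * cos (Im z).
Proof. by rewrite /cexp ReM /= mul0r subr0. Qed.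

Lemma Im_cexp z : Im (cexp z) = expR (Re z) * sin (Im z).
Proof. by rewrite /cexp ImM /= mul0r addr0. Qed.

Lemma complex_ext z w : Re z = Re w -> Im z = Im w -> z = w.
Proof. by case: z w => [? ?] [? ?] /= -> ->. Qed.

Lemma cexpD z w : cexp (z + w) = cexp z * cexp w.
Proof.
apply: complex_ext.
  by rewrite Re_cexp ReM !Re_cexp !Im_cexp !raddfD/= expRD cosD; ring.
by rewrite Im_cexp ImM !Re_cexp !Im_cexp !raddfD/= expRD sinD; ring.
Qed.

Lemma conj_cexp z : conjc (cexp z) = cexp (conjc z).
Proof.
apply: complex_ext.
  by rewrite Re_cexp; case: z => a b; rewrite /= mul0r subr0 cosN.
by rewrite Im_cexp; case: z => a b; rewrite /= mul0r addr0 sinN mulrN.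
Qed.

Lemma mul_ii : 'i * 'i = -1 :> R[i].
Proof. by rewrite -expr2 sqr_i. Qed.

Lemma conjc_real (r : R) : conjc r%:C = r%:C.
Proof. by apply: complex_ext; rewrite /= ?oppr0. Qed.

Lemma conjc_i : conjc 'i = - 'i :> R[i].
Proof. by apply: complex_ext; rewrite /= ?oppr0. Qed.

Lemma conjcM (z z' : R[i]) : conjc (z * z') = conjc z * conjc z'.
Proof. exact: rmorphM. Qed.

Lemma conjcD (z z' : R[i]) : conjc (z + z') = conjc z + conjc z'.
Proof. exact: rmorphD. Qed.

End complex_exp.

Section complex_integral.
Local Open Scope complex_scope.
Context d (T : measurableType d) (R : realType).
Local Notation Re := (@complex.Re R).
Local Notation Im := (@complex.Im R).

Definition cmeasurable (F : T -> R[i]) :=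
  measurable_fun setT (fun x => Re (F x)) /\
  measurable_fun setT (fun x => Im (F x)).

Lemma cmeasurable_cst z : cmeasurable (fun=> z).
Proof. by split. Qed.

Lemma cmeasurable_real (f : T -> R) :
  measurable_fun setT f -> cmeasurable (fun x => (f x)%:C).
Proof. by split. Qed.

Lemma cmeasurableD F G : cmeasurable F -> cmeasurable G ->
  cmeasurable (fun x => F x + G x).
Proof.
move=> [Fr Fi] [Gr Gi]; split; under eq_fun do rewrite raddfD; exact: measurable_funD.
Qed.

Lemma cmeasurableM F G : cmeasurable F -> cmeasurable G ->
  cmeasurable (fun x => F x * G x).
Proof.
move=> [Fr Fi] [Gr Gi]; split.
  under eq_fun do rewrite ReM.
  by apply: measurable_funB; exact: measurable_funM.
under eq_fun do rewrite ImM.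
by apply: measurable_funD; exact: measurable_funM.
Qed.

Lemma cmeasurable_sum (I : Type) (r : seq I) (F : I -> T -> R[i]) :
  (forall i, cmeasurable (F i)) -> cmeasurable (fun x => \sum_(i <- r) F i x).
Proof.
move=> mF; elim: r => [|i r IHr].
  by under eq_fun do rewrite big_nil; exact: cmeasurable_cst.
by under eq_fun do rewrite big_cons; exact: cmeasurableD.
Qed.

Lemma cmeasurable_cexp F : cmeasurable F -> cmeasurable (fun x => cexp (F x)).
Proof.
move=> [Fr Fi]; split.
  under eq_fun do rewrite Re_cexp.
  apply: measurable_funM; apply: measurableT_comp => //.
  by apply: continuous_measurable_fun; exact: continuous_cos.
under eq_fun do rewrite Im_cexp.
apply: measurable_funM; apply: measurableT_comp => //.
by apply: continuous_measurable_fun; exact: continuous_sin.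
Qed.

Section integral.
Variable mu : {measure set T -> \bar R}.

Definition cintegrable (F : T -> R[i]) :=
  mu.-integrable setT (EFin \o (fun x => Re (F x))) /\
  mu.-integrable setT (EFin \o (fun x => Im (F x))).

Definition cintegral (F : T -> R[i]) : R[i] :=
  (\int[mu]_x Re (F x)) +i* (\int[mu]_x Im (F x)).

Lemma cintegralZl z F : cintegrable F ->
  cintegral (fun x => z * F x) = z * cintegral F.
Proof.
move=> [Fr Fi]; apply: complex_ext.
  rewrite ReM /= -!RintegralZl// -RintegralB//.
  - by apply: eq_Rintegral => x _; rewrite ReM.
  - by have := integrableZl measurableT (Re z) Fr.
  - by have := integrableZl measurableT (Im z) Fi.
rewrite ImM /= -!RintegralZl// -RintegralD//.
- by apply: eq_Rintegral => x _; rewrite ImM.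
- by have := integrableZl measurableT (Re z) Fi.
- by have := integrableZl measurableT (Im z) Fr.
Qed.

End integral.
End complex_integral.

(** * Fubini with a factor of constant integral along the fibres *)

Section fibre.
Context d1 d2 (T1 : measurableType d1) (T2 : measurableType d2) (R : realType).
Variables (m1 : {sigma_finite_measure set T1 -> \bar R}).
Variables (m2 : {sigma_finite_measure set T2 -> \bar R}).

Section real.
Variables (N k : T1 * T2 -> R) (g : T2 -> R) (M m : R).
Hypotheses (mN : measurable_fun setT N) (mk : measurable_fun setT k).
Hypothesis kN : forall z, `|k z| <= N z.
Hypothesis N_M : forall y, (\int[m1]_x (N (x, y))%:E)%E = M%:E.
Hypothesis k_m : forall y, \int[m1]_x k (x, y) = m.
Hypothesis ig : m2.-integrable setT (EFin \o g).

Let mg : measurable_fun setT g.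
Proof. by apply/measurable_EFinP; exact: measurable_int ig. Qed.

Let mkg : measurable_fun setT (fun z : T1 * T2 => k z * g z.2).
Proof. by apply: measurable_funM => //; exact: measurableT_comp. Qed.

Let mNy y : measurable_fun setT (fun x => N (x, y)).
Proof. exact: measurableT_comp. Qed.

Let mky y : measurable_fun setT (fun x => k (x, y)).
Proof. exact: measurableT_comp. Qed.

Let N0 z : 0 <= N z.
Proof. exact: le_trans (kN z). Qed.

(** Tonelli: the majorant N has the same mass M on all fibres, so the iterated
    integral of |k g| is at most M times the integral of |g|. *)
Lemma integrable_fibre : (m1 \x m2)%E.-integrable setT (fun z => (k z * g z.2)%:E).
Proof.
apply/integrable21ltyP => /=; first exact/measurable_EFinP.
apply: (@le_lt_trans _ _ (\int[m2]_y (M%:E * `|(g y)%:E|))%E).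
  apply: ge0_le_integral => //=.
  - by move=> y _; apply: integral_ge0.
  - apply: (@measurable_fun_fubini_tonelli_G _ _ _ _ _ m1
      (fun z => `|(k z * g z.2)%:E|%E)) => //.
    by apply: measurableT_comp => //; exact/measurable_EFinP.
  - by apply: measurable_funeM; apply/measurable_EFinP; exact: measurableT_comp.
  - move=> y _; rewrite -(N_M y) -ge0_integralZr//.
    + apply: ge0_le_integral => //=.
      * apply/measurable_EFinP; apply: measurableT_comp => //.
        exact: measurable_funM.
      * by apply/measurable_EFinP; exact: measurable_funM.
      * by move=> x _; rewrite normrM lee_fin ler_wpM2r.
    + exact/measurable_EFinP.
    + by move=> x _; rewrite lee_fin.
have [igm iglty] := integrableP _ _ _ ig.
rewrite integralZl//; last exact: integrable_abse.
by rewrite lte_mul_pinfty// -(N_M point) integral_ge0// => x _; rewrite lee_fin.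
Qed.

Lemma Rintegral_fibre : \int[(m1 \x m2)%E]_z (k z * g z.2) = m * \int[m2]_y g y.
Proof.
rewrite -RintegralZl// /Rintegral -(integral21_prod_meas1 integrable_fibre).
congr fine; apply: eq_integral => y _; rewrite /fubini_G /=.
under eq_integral do rewrite EFinM.
have iN : m1.-integrable setT (fun x => (N (x, y))%:E).
  apply/integrableP; split; first exact/measurable_EFinP.
  by under eq_integral do rewrite gee0_abs ?lee_fin//; rewrite N_M ltry.
have ik : m1.-integrable setT (fun x => (k (x, y))%:E).
  apply: le_integrable iN => //; first exact/measurable_EFinP.
  by move=> x _ /=; rewrite lee_fin (le_trans (kN _))// ler_norm.
rewrite integralZr// -(k_m y) /Rintegral EFinM fineK//.
exact: integrable_fin_num.
Qed.
End real.

Section complex.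
Variables (N : T1 * T2 -> R) (K : T1 * T2 -> R[i]) (G : T2 -> R[i]).
Variables (M : R) (c : R[i]).
Local Notation Re := (@complex.Re R).
Local Notation Im := (@complex.Im R).
Hypotheses (mN : measurable_fun setT N) (mK : cmeasurable K).
Hypothesis ReK : forall z, `|Re (K z)| <= N z.
Hypothesis ImK : forall z, `|Im (K z)| <= N z.
Hypothesis N_M : forall y, (\int[m1]_x (N (x, y))%:E)%E = M%:E.
Hypothesis K_c : forall y, cintegral m1 (fun x => K (x, y)) = c.
Hypothesis iG : cintegrable m2 G.

Let ReKc y : \int[m1]_x Re (K (x, y)) = Re c.
Proof. by rewrite -(K_c y). Qed.

Let ImKc y : \int[m1]_x Im (K (x, y)) = Im c.
Proof. by rewrite -(K_c y). Qed.

(** The form of Fubini for a kernel K whose integral along the fibre over y is a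
    constant c, although K itself depends on y: this is what happens to a
    Gaussian whose centre depends on y.  A majorant N dominates Re K and Im K
    because N is easier to integrate than the modulus of K. *)
Lemma cintegral_fibre : cintegrable (m1 \x m2)%E (fun z => K z * G z.2) /\
  cintegral (m1 \x m2)%E (fun z => K z * G z.2) = c * cintegral m2 G.
Proof.
have [[mRK mIK] [iRG iIG]] := (mK, iG).
have rr := integrable_fibre mN mRK ReK N_M iRG.
have ii := integrable_fibre mN mIK ImK N_M iIG.
have ri := integrable_fibre mN mRK ReK N_M iIG.
have ir := integrable_fibre mN mIK ImK N_M iRG.
split; first split => /=.
- apply: eq_integrable (integrableB measurableT rr ii) => // z _ /=.
  by rewrite ReM.
- apply: eq_integrable (integrableD measurableT ri ir) => // z _ /=.
  by rewrite ImM.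
- apply: complex_ext => /=.
  under eq_Rintegral do rewrite ReM.
  rewrite RintegralB// (Rintegral_fibre mN mRK ReK N_M ReKc iRG).
  by rewrite (Rintegral_fibre mN mIK ImK N_M ImKc iIG) ReM.
- under eq_Rintegral do rewrite ImM.
  rewrite RintegralD// (Rintegral_fibre mN mRK ReK N_M ReKc iIG).
  by rewrite (Rintegral_fibre mN mIK ImK N_M ImKc iRG) ImM.
Qed.
End complex.
End fibre.

Section pushforward.
Context (R : realType) (n : nat).
Variable mu : {sigma_finite_measure set (n.-tuple (measurableTypeR R)) -> \bar R}.
Local Notation mR := (measurableTypeR R).

Lemma cintegral_lebesgue_step (F : n.+1.-tuple mR -> R[i]) :
  cmeasurable F ->
  cintegrable (@lebesgue_measure R \x mu)%E (F \o @cons_pair R n) ->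
  cintegrable (lebesgue_step mu) F /\
  cintegral (lebesgue_step mu) F =
    cintegral (@lebesgue_measure R \x mu)%E (F \o @cons_pair R n).
Proof.
move=> [mRF mIF] [iR iI].
have mc := @measurable_cons_pair R n.
have real (f : n.+1.-tuple mR -> R) : measurable_fun setT f ->
    (@lebesgue_measure R \x mu)%E.-integrable setT (EFin \o (f \o @cons_pair R n)) ->
    (lebesgue_step mu).-integrable setT (EFin \o f) /\
    \int[lebesgue_step mu]_t f t =
      \int[(@lebesgue_measure R \x mu)%E]_z f (cons_pair z).
  move=> /measurable_EFinP mf intf; split.
    exact: (integrable_pushforward mc mf intf measurableT).
  congr fine; exact: (integral_pushforward mc mf intf measurableT).
have [iR' eR] := real _ mRF iR; have [iI' eI] := real _ mIF iI.
by split; [split|apply: complex_ext].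
Qed.
End pushforward.

(** * Quadratic forms and Schur complements *)

Section dot_product.
Context (K : comPzRingType).

Lemma dotmxC m (x y : 'cV[K]_m) : dotmx x y = dotmx y x.
Proof. by rewrite /dotmx -[x^T *m y]trmxK trmx_mul trmxK [LHS]mxE. Qed.

Lemma dotmxDr m (x y z : 'cV[K]_m) : dotmx x (y + z) = dotmx x y + dotmx x z.
Proof. by rewrite /dotmx mulmxDr [LHS]mxE. Qed.

Lemma dotmxDl m (x y z : 'cV[K]_m) : dotmx (y + z) x = dotmx y x + dotmx z x.
Proof. by rewrite ![dotmx _ x]dotmxC dotmxDr. Qed.

Lemma dotmxZr m (x y : 'cV[K]_m) a : dotmx x (a *: y) = a * dotmx x y.
Proof. by rewrite /dotmx -scalemxAr [LHS]mxE. Qed.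

Lemma dotmxZl m (x y : 'cV[K]_m) a : dotmx (a *: x) y = a * dotmx x y.
Proof. by rewrite dotmxC dotmxZr dotmxC. Qed.

Lemma dotmxNr m (x y : 'cV[K]_m) : dotmx x (- y) = - dotmx x y.
Proof. by rewrite -scaleN1r dotmxZr mulN1r. Qed.

Lemma dotmxMr m (A : 'M[K]_m) (x y : 'cV[K]_m) :
  dotmx x (A *m y) = dotmx (A^T *m x) y.
Proof. by rewrite /dotmx trmx_mul trmxK mulmxA. Qed.

Lemma dotmx_outer m (w u x : 'cV[K]_m) :
  dotmx w (u *m u^T *m x) = dotmx w u * dotmx u x.
Proof. by rewrite /dotmx !mulmxA -mulmxA [LHS]mxE big_ord1. Qed.

Lemma dotmx_col m1 m2 (x1 y1 : 'cV[K]_m1) (x2 y2 : 'cV[K]_m2) :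
  dotmx (col_mx x1 x2) (col_mx y1 y2) = dotmx x1 y1 + dotmx x2 y2.
Proof. by rewrite /dotmx tr_col_mx mul_row_col [LHS]mxE. Qed.

Lemma dotmx_scalar a (x : 'cV[K]_1) : dotmx a%:M x = a * x 0 0.
Proof. by rewrite /dotmx tr_scalar_mx mul_scalar_mx mxE. Qed.

Definition qform m (Y : 'M[K]_m) (x : 'cV[K]_m) : K := dotmx x (Y *m x).

Lemma dotmx_sym m (A : 'M[K]_m) (x y : 'cV[K]_m) :
  A^T = A -> dotmx x (A *m y) = dotmx y (A *m x).
Proof. by move=> As; rewrite dotmxMr As dotmxC. Qed.

Lemma qformD m (A : 'M[K]_m) (x y : 'cV[K]_m) : A^T = A ->
  qform A (x + y) = qform A x + 2 * dotmx x (A *m y) + qform A y.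
Proof.
move=> As; rewrite /qform mulmxDr dotmxDl !dotmxDr [dotmx y (A *m x)]dotmx_sym//.
by ring.
Qed.

Lemma qformZ m (A : 'M[K]_m) k (x : 'cV[K]_m) : qform A (k *: x) = k ^+ 2 * qform A x.
Proof. by rewrite /qform -scalemxAr dotmxZl dotmxZr mulrA expr2. Qed.

End dot_product.

Section schur.
Context (K : fieldType) (n : nat).
Implicit Types (a : K) (u w : 'cV[K]_n) (B : 'M[K]_n).

Definition schur_compl a u B : 'M[K]_n := B - a^-1 *: (u *m u^T).

(** One step of Gaussian elimination. *)
Lemma det_schur a u B : a != 0 ->
  \det (block_mx a%:M u^T u B : 'M[K]_(1 + n)) = a * \det (schur_compl a u B).
Proof.
move=> a0.
have -> : block_mx a%:M u^T u B =
    block_mx 1%:M 0 (a^-1 *: u) 1%:M *m block_mx a%:M u^T 0 (schur_compl a u B).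
  rewrite mulmx_block !mul1mx !mul0mx ?mulmx0 !addr0 mul_mx_scalar.
  by rewrite scalerA mulfV// scale1r -scalemxAl addrC subrK.
by rewrite det_mulmx det_lblock det_ublock !det1 !mul1r det_scalar1.
Qed.

(** Completion of the square in the first coordinate. *)
Lemma qform_schur a u B (x0 : K) w : a != 0 ->
  qform (block_mx a%:M u^T u B) (col_mx x0%:M w) =
  a * (x0 + a^-1 * dotmx u w) ^+ 2 + qform (schur_compl a u B) w.
Proof.
move=> a0; rewrite /qform mul_block_col dotmx_col dotmx_scalar.
rewrite -scalar_mxM mul_mx_scalar dotmxDr dotmxZr mulmxBl dotmxDr dotmxNr.
rewrite -scalemxAl dotmxZr dotmx_outer [dotmx w u]dotmxC.
have -> : ((a * x0)%:M + u^T *m w) 0 0 = a * x0 + dotmx u w.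
  by rewrite mxE [X in X + _]mxE mulr1n.
by field.
Qed.
End schur.

Section complex_matrices.
Context (R : realType).
Local Open Scope complex_scope.

Lemma cplxmxM m n p (A : 'M[R]_(m, n)) (B : 'M[R]_(n, p)) :
  cplxmx (A *m B) = cplxmx A *m cplxmx B.
Proof. exact: map_mxM. Qed.

Lemma cplxmx_decomp m1 m2 (A : 'M[R[i]]_(m1, m2)) :
  A = cplxmx (remx A) + 'i *: cplxmx (immx A).
Proof.
by apply/matrixP => j l; rewrite !mxE; apply: complex_ext; case: (A j l) => p q;
  rewrite /=; ring.
Qed.

Lemma conjmx_decomp m1 m2 (A : 'M[R[i]]_(m1, m2)) :
  conjmx A = cplxmx (remx A) - 'i *: cplxmx (immx A).
Proof.
by apply/matrixP => j l; rewrite !mxE; apply: complex_ext; case: (A j l) => p q;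
  rewrite /=; ring.
Qed.

Lemma conjmx_cplx m1 m2 (A : 'M[R]_(m1, m2)) : conjmx (cplxmx A) = cplxmx A.
Proof.
by apply/matrixP => j l; rewrite !mxE; apply: complex_ext; rewrite /= ?oppr0.
Qed.

Lemma cplxmxD m1 m2 (A B : 'M[R]_(m1, m2)) : cplxmx (A + B) = cplxmx A + cplxmx B.
Proof. exact: map_mxD. Qed.

Lemma conjc_dotmx m (x y : 'cV[R[i]]_m) :
  conjc (dotmx x y) = dotmx (conjmx x) (conjmx y).
Proof. by rewrite /dotmx /conjmx map_trmx -map_mxM [in RHS]mxE. Qed.

Lemma conjmxM m1 m2 m3 (A : 'M[R[i]]_(m1, m2)) (B : 'M[R[i]]_(m2, m3)) :
  conjmx (A *m B) = conjmx A *m conjmx B.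
Proof. exact: map_mxM. Qed.

Lemma dotmx_cplx n (x y : 'cV[R]_n) :
  dotmx (cplxmx x) (cplxmx y) = (dotmx x y)%:C.
Proof. by rewrite /dotmx map_trmx -cplxmxM mxE. Qed.

Lemma cplx_schur n a (u : 'cV[R]_n) B :
  cplxmx (schur_compl a u B) = schur_compl a%:C (cplxmx u) (cplxmx B).
Proof.
rewrite /schur_compl /cplxmx map_mxB map_mxZ map_mxM -map_trmx.
by congr (_ - _ *: _); rewrite fmorphV.
Qed.

(** The vector (- a^-1 u^t x, x) annihilates the square in [qform_schur], so the
    Schur complement takes at x a value of the whole form. *)
Lemma posdef_schur n a (u : 'cV[R]_n) B :
  posdefmx (block_mx a%:M u^T u B : 'M[R]_(1 + n)) ->
  0 < a /\ posdefmx (schur_compl a u B).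
Proof.
move=> Ypos.
have a0 : 0 < a.
  have := Ypos (col_mx 1%:M 0); rewrite mul_block_col dotmx_col !mulmx0 !addr0.
  rewrite dotmx_scalar mulmx1 [dotmx 0 _]dotmxC /dotmx mulmx0 !mxE mul1r mulr1n addr0.
  apply; apply: contraTneq isT => /(congr1 usubmx).
  by rewrite col_mxKu linear0 => /matrixP/(_ 0 0)/eqP; rewrite !mxE oner_eq0.
split=> // x x0.
have := Ypos (col_mx (- (a^-1 * dotmx u x))%:M x).
rewrite -/(qform _ _) qform_schur ?gt_eqF// addNr expr0n mulr0 add0r; apply.
by apply: contra_neq x0 => /(congr1 dsubmx); rewrite col_mxKd linear0.
Qed.

Lemma symmetric_block n (Y : 'M[R]_(1 + n)) : Y^T = Y ->
  Y = block_mx (Y 0 0)%:M (dlsubmx Y)^T (dlsubmx Y) (drsubmx Y).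
Proof.
move=> Ysym; rewrite -[LHS]submxK; congr block_mx; last by rewrite trmx_dlsub Ysym.
rewrite [LHS]mx11_scalar !mxE; congr (Y _ _)%:M; exact/val_inj.
Qed.

Lemma sym_schur n a (u : 'cV[R]_n) B : B^T = B ->
  (schur_compl a u B)^T = schur_compl a u B.
Proof.
by move=> Bs; rewrite /schur_compl linearB/= linearZ/= trmx_mul trmxK Bs.
Qed.

Lemma posdef_det_gt0 n (Y : 'M[R]_n) : Y^T = Y -> posdefmx Y -> 0 < \det Y.
Proof.
elim: n => [|n IHn] in Y *; first by rewrite det_mx00 ltr01.
rewrite -[n.+1]/(1 + n)%N in Y * => Ysym.
have Bs : (drsubmx Y)^T = drsubmx Y by rewrite trmx_drsub Ysym.
rewrite (symmetric_block Ysym) => /posdef_schur[a0 Spos].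
by rewrite det_schur ?gt_eqF// mulr_gt0// IHn// sym_schur.
Qed.

End complex_matrices.

(** * The Gaussian integral in dimension n *)

Section gauss_integral.
Context (R : realType).
Local Open Scope complex_scope.
Local Notation mR := (measurableTypeR R).
Local Notation mu := (@lebesgue_measure R).
Local Notation Re := (@complex.Re R).
Local Notation Im := (@complex.Im R).

Definition cgauss (a : R) (z : R[i]) := cexp (- a%:C * z ^+ 2).

Local Arguments cexp : simpl never.
Local Arguments cgauss : simpl never.

Lemma Re_cgauss a (x : R) z :
  Re (cgauss a (x%:C + z)) = gauss_wave a 1 0 (Im z) (x + Re z).
Proof.
case: z => p q; rewrite /cgauss Re_cexp /gauss_wave mul1r mul0r addr0 expr2.
by rewrite /= -[in RHS]cosN; congr (expR _ * cos _); ring.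
Qed.

Lemma Im_cgauss a (x : R) z :
  Im (cgauss a (x%:C + z)) = gauss_wave a 0 (-1) (Im z) (x + Re z).
Proof.
case: z => p q; rewrite /cgauss Im_cexp /gauss_wave mul0r add0r expr2 mulN1r.
by rewrite /= -[in RHS]sinN; congr (expR _ * sin _); ring.
Qed.

(** The modulus of exp (- a (x + z)^2). *)
Definition cgauss_env (a : R) (x : R) (z : R[i]) :=
  expR (a * Im z ^+ 2) * expR (- a * (x + Re z) ^+ 2).

Lemma Re_cgauss_le a (x : R) z : 0 < a ->
  `|Re (cgauss a (x%:C + z))| <= cgauss_env a x z.
Proof.
move=> a0; rewrite Re_cgauss (le_trans (gauss_wave_le _ _ _ a0 (lexx _)))//.
by rewrite normr0 addr0 normr1 mul1r real_normK ?num_real.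
Qed.

Lemma Im_cgauss_le a (x : R) z : 0 < a ->
  `|Im (cgauss a (x%:C + z))| <= cgauss_env a x z.
Proof.
move=> a0; rewrite Im_cgauss (le_trans (gauss_wave_le _ _ _ a0 (lexx _)))//.
by rewrite normr0 add0r normrN normr1 mul1r real_normK ?num_real.
Qed.

Lemma ge0_integral_cgauss_env a z : 0 < a ->
  (\int[mu]_x (cgauss_env a x z)%:E)%E =
  (expR (a * Im z ^+ 2) * Num.sqrt (pi / a))%:E.
Proof.
move=> a0; under eq_integral do rewrite EFinM.
rewrite ge0_integralZl_EFin ?expR_ge0//.
  by rewrite ge0_integral_gauss// EFinM.
apply/measurable_EFinP; apply: measurableT_comp => //; apply: measurable_funM => //.
by apply: measurable_funX; exact: measurable_funD.
Qed.

Lemma cintegral_cgauss a z : 0 < a ->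
  cintegral mu (fun x => cgauss a ((x : R)%:C + z)) = (Num.sqrt (pi / a))%:C.
Proof.
move=> a0; rewrite /cintegral; congr Complex.
  rewrite -[RHS]mul1r -(Rintegral_gauss_wave 1 0 (Im z) (Re z) a0).
  by apply: eq_Rintegral => x _; rewrite Re_cgauss.
rewrite -[RHS](mul0r (Num.sqrt (pi / a))).
rewrite -(Rintegral_gauss_wave 0 (- 1) (Im z) (Re z) a0).
by apply: eq_Rintegral => x _; rewrite Im_cgauss.
Qed.

Definition cvec n (t : n.-tuple mR) : 'cV[R]_n := \col_i tnth t i.

Lemma cvec_cons n (x : mR) (t : n.-tuple mR) :
  cvec (cons_pair (x, t)) = col_mx (x%:M : 'cV_1) (cvec t).
Proof.
apply/matrixP => i j; rewrite !mxE; case: splitP => k ik.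
  rewrite [k]ord1 in ik *; rewrite (_ : i = ord0)//; last exact/val_inj.
  by rewrite !mxE ord1 eqxx mulr1n.
by rewrite (_ : i = lift ord0 k) ?tnthS ?mxE//; exact/val_inj.
Qed.

Lemma measurable_cvec n i : measurable_fun setT (fun t : n.-tuple mR => cvec t i 0).
Proof. by under eq_fun do rewrite mxE; exact: measurable_tnth. Qed.

Lemma measurable_dot_cvec n (u : 'cV[R]_n) :
  measurable_fun setT (fun t : n.-tuple mR => dotmx u (cvec t)).
Proof.
under eq_fun do rewrite /dotmx mxE.
apply: measurable_sum => i; apply: measurable_funM => //.
exact: measurable_cvec.
Qed.

Lemma cmeasurable_qform n (Y : 'M[R[i]]_n) s :
  cmeasurable (fun t : n.-tuple mR => qform Y (cplxmx (cvec t) + s)).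
Proof.
have me i : cmeasurable (fun t : n.-tuple mR => (cplxmx (cvec t) + s) i 0).
  under eq_fun do rewrite mxE [cplxmx _ _ _]mxE.
  apply: cmeasurableD; last exact: cmeasurable_cst.
  by apply: cmeasurable_real; exact: measurable_cvec.
under eq_fun do rewrite /qform /dotmx mxE.
apply: cmeasurable_sum => i; apply: cmeasurableM.
  by under eq_fun do rewrite mxE; exact: me.
under eq_fun do rewrite mxE.
apply: cmeasurable_sum => j; apply: cmeasurableM; last exact: me.
exact: cmeasurable_cst.
Qed.

(** Induction on n by the Schur complement S of the entry a = Y 0 0.  The
    integrand factors as K G, where G is the integrand of S and K is the
    one-dimensional Gaussian in the first coordinate, centred at a point z t
    which depends on the other coordinates t.  Its integral is
    (2 a)^(-1/2) for every t.  The centre moves only by a real amount, so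
    Im (z t) is constant, and so is the integral of the modulus of K; this
    uniformity gives the integrability needed for Fubini. *)
Lemma cintegral_gauss n (Y : 'M[R]_n) (s : 'cV[R[i]]_n) :
    Y^T = Y -> posdefmx Y ->
  let F := fun t =>
    cexp (- (2 * pi)%:C * qform (cplxmx Y) (cplxmx (cvec t) + s)) in
  cintegrable (lebesgue_tuple R n) F /\
  cintegral (lebesgue_tuple R n) F = ((Num.sqrt (2 ^+ n * \det Y))^-1)%:C.
Proof.
elim: n => [|n IHn] in Y s *.
  (* On R^0 the integrand is 1, and the measure is a Dirac mass. *)
  move=> _ _; set F := fun _ => _; have F1 t : F t = 1.
    by rewrite /F /qform /dotmx mxE big_ord0 mulr0 /cexp /= expR0 cos0 sin0 mul1r.
  have FE : F = cst 1 by apply/funext.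
  rewrite FE expr0 mul1r det_mx00 sqrtr1 invr1.
  have fin (r : R) : (lebesgue_tuple R 0).-integrable setT (EFin \o cst r).
    exact: (finite_measure_integrable_cst (\d_([tuple] : 0.-tuple mR)) r).
  split; first by split; exact: fin.
  rewrite /cintegral.
  rewrite (@Rintegral_cst _ _ _ (lebesgue_tuple R 0) _ measurableT 1).
  rewrite (@Rintegral_cst _ _ _ (lebesgue_tuple R 0) _ measurableT 0).
  have T1 := congr1 fine (diracT R ([tuple] : 0.-tuple mR)).
  by rewrite [fine _]T1 mul0r mul1r.
rewrite -[n.+1]/(1 + n)%N in Y s * => Ysym.
rewrite (symmetric_block Ysym).
have Bs : (drsubmx Y)^T = drsubmx Y by rewrite trmx_drsub Ysym.
move: (Y 0 0) (dlsubmx Y) (drsubmx Y) Bs => a u B Bs {Y Ysym}.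
move=> /posdef_schur[a0 Spos].
have a0' : a != 0 by rewrite gt_eqF.
have ac0 : a%:C != 0 :> R[i] by rewrite (inj_eq (@complexI R)).
rewrite det_schur// exprS.
have [] := IHn _ (dsubmx s) (sym_schur a u Bs) Spos.
set G := fun t => cexp _.
set S := schur_compl a u B in Spos *.
move=> iG IG F.
pose b := 2 * pi * a.
have b0 : 0 < b by rewrite !mulr_gt0// pi_gt0.
pose z0 := s 0 0 + (a%:C)^-1 * dotmx (cplxmx u) (dsubmx s).
pose z (t : n.-tuple mR) := (a^-1 * dotmx u (cvec t))%:C + z0.
pose K (p : mR * n.-tuple mR) := cgauss b (p.1%:C + z p.2).
have FKG p : F (cons_pair p) = K p * G p.2.
  case: p => x t; rewrite /F /K /G /cgauss -cexpD /=.
  rewrite cvec_cons {1 2}/cplxmx map_block_mx map_col_mx !map_scalar_mx -map_trmx.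
  rewrite -[s]vsubmxK add_col_mx [usubmx s]mx11_scalar -(raddfD (@scalar_mx _ 1)).
  rewrite qform_schur// -!/(cplxmx _) -cplx_schur -/S.
  have us : usubmx s 0 0 = s 0 0 by rewrite mxE; congr (s _ _); exact/val_inj.
  rewrite col_mxKd dotmxDr dotmx_cplx us /z /z0 /b /=.
  by congr cexp; rewrite !rmorphM fmorphV /=; ring.
have FE : F \o @cons_pair R n = (fun p => K p * G p.2) by apply/funext => p /=.
have zE t : Im (z t) = Im z0 by rewrite /z raddfD /= add0r.
pose N (p : mR * n.-tuple mR) := cgauss_env b p.1 (z p.2).
pose M := expR (b * Im z0 ^+ 2) * Num.sqrt (pi / b).
have mz : cmeasurable z.
  apply: cmeasurableD; last exact: cmeasurable_cst.
  by apply: cmeasurable_real; apply: measurable_funM => //; exact: measurable_dot_cvec.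
have mz2 : cmeasurable (fun p : mR * n.-tuple mR => z p.2).
  case: mz => mr mi; split.
    exact: (measurableT_comp mr measurable_snd).
  exact: (measurableT_comp mi measurable_snd).
have mN : measurable_fun setT N.
  case: mz2 => mr mi; apply: measurable_funM.
    apply: measurableT_comp => //; apply: measurable_funM => //.
    exact: measurable_funX.
  apply: measurableT_comp => //; apply: measurable_funM => //.
  by apply: measurable_funX; exact: measurable_funD.
have mK : cmeasurable K.
  apply: cmeasurable_cexp; apply: cmeasurableM; first exact: cmeasurable_cst.
  suff : cmeasurable (fun p : mR * n.-tuple mR => (p.1 : R)%:C + z p.2).
    by move=> mxz; exact: cmeasurableM.
  by apply: cmeasurableD => //; exact: cmeasurable_real.
have mF : cmeasurable F.
  apply: cmeasurable_cexp; apply: cmeasurableM; first exact: cmeasurable_cst.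
  exact: cmeasurable_qform.
have [] := @cintegral_fibre _ _ _ _ R mu (lebesgue_tuple R n) N K G M
  (Num.sqrt (pi / b))%:C mN mK _ _ _ _ iG.
- by move=> p; exact: Re_cgauss_le.
- by move=> p; exact: Im_cgauss_le.
- by move=> t; rewrite /N /= ge0_integral_cgauss_env// zE.
- by move=> t; rewrite -(cintegral_cgauss (z t) b0).
rewrite -FE => iF IF.
have [iF' IF'] := cintegral_lebesgue_step mF iF; split; first exact: iF'.
rewrite IF' IF IG -rmorphM/=; congr (_%:C).
have -> : pi / b = (2 * a)^-1.
  rewrite /b; move: (pi : R) (lt0r_neq0 (pi_gt0 R)) => p p0.
  by field; rewrite a0'.
have a2 : 0 <= 2 * a by rewrite mulr_ge0// ltW.
by rewrite sqrtrV// mulrACA [in RHS]sqrtrM// -invfM.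
Qed.
End gauss_integral.

(** * Identities between exponents *)

(** The entries of the matrices and vectors are taken in an abstract field K
    with a square root i of -1, standing for the complex numbers: S, Y, a and b
    stand for Re T, Im T, Re c and Im c, and Y' for the inverse of Y; P stands
    for the number pi.  A point of phase space is a pair of vectors p and q. *)

Section theta_exponent.
Context (K : numFieldType) (n : nat) (i P : K) (S Y Y' : 'M[K]_n) (a b : 'cV[K]_n).
Hypotheses (i2 : i * i = -1) (S_sym : S^T = S) (Y_sym : Y^T = Y).
Hypotheses (Y'_sym : Y'^T = Y') (YinvY : Y *m Y' = 1%:M).
Implicit Types p q x y z : 'cV[K]_n.

Lemma dotmx_mul_inv x y : dotmx (Y *m x) (Y' *m y) = dotmx x y.
Proof. by rewrite dotmxMr Y'_sym mulmxA (mulmx1C YinvY) mul1mx. Qed.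

(** The starred underlined vector; the unstarred one exceeds it by 2 i Y p, see
    [ustar_unstar], and is eliminated everywhere in its favour. *)
Definition ustar p q := S *m p - i *: (Y *m p) + q.

Lemma ustar_unstar p q : (S + i *: Y) *m p + q = ustar p q + (2 * i) *: (Y *m p).
Proof.
rewrite /ustar mulmxDl -scalemxAl [RHS]addrAC; congr (_ + _).
by rewrite -addrA -scaleNr -scalerDl; congr (_ + _ *: _); ring.
Qed.

(** The exponents H_c and X, written with [ustar]. *)
Definition Hform p q :=
  dotmx (ustar p q + (2 * i) *: (Y *m p) - (2 * i) *: b)
    (Y' *m (ustar p q - (2 * i) *: b)) +
  4 * i * dotmx p a.

Definition Xform p q p' q' :=
  dotmx (ustar p q + (2 * i) *: (Y *m p)) (Y' *m ustar p' q') +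
  2 * dotmx b (Y' *m b).

Lemma dotmx_ustar x p q : dotmx x (ustar p q) =
  dotmx x (S *m p) - i * dotmx x (Y *m p) + dotmx x q.
Proof. by rewrite /ustar 2!dotmxDr dotmxNr dotmxZr. Qed.

Lemma HformE p q (v := ustar p q - (2 * i) *: b) :
  Hform p q = qform Y' v + 2 * i * dotmx p v + 4 * i * dotmx p a.
Proof. by rewrite /Hform addrAC -/v dotmxDl dotmxZl dotmx_mul_inv. Qed.

(** Completion of the square in the overlap of the Gaussian with its translate.
    The quadratic part of the exponent is - 2 P times the form of Y and its
    linear part is - 2 P i v; the shift (i / 2) Y' v absorbs the latter, and the
    constant which remains is the exponent of C. *)
Lemma gauss_exponent p q x (v := ustar p q - (2 * i) *: b) :
  P * i * dotmx x ((S + i *: Y) *m x) + 2 * P * i * dotmx (a + i *: b) x +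
  (- ((2 * P * dotmx x q + P * dotmx p q) * i) +
   - (P * i * dotmx (x + p) ((S - i *: Y) *m (x + p)) +
     2 * P * i * dotmx (a - i *: b) (x + p))) =
  - (P / 2) * Hform p q + - (2 * P) * qform Y (x + (i / 2) *: (Y' *m v)).
Proof.
have vE y : dotmx y v = dotmx y (S *m p) - i * dotmx y (Y *m p) + dotmx y q -
    2 * i * dotmx y b.
  by rewrite /v dotmxDr dotmxNr dotmxZr dotmx_ustar.
have Yv : Y *m (Y' *m v) = v by rewrite mulmxA YinvY mul1mx.
rewrite HformE -/v [qform Y (x + _)]qformD// qformZ -scalemxAr Yv.
have -> : qform Y (Y' *m v) = qform Y' v by rewrite /qform Yv dotmxC.
rewrite dotmxZr !vE; move: (qform Y' v) => V.
rewrite [_ *m x]mulmxDl mulmxBl -!scalemxAl.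
rewrite [dotmx x (_ + _)]dotmxDr [dotmx _ (_ - _)]dotmxDr dotmxNr !dotmxZr.
rewrite ![dotmx _ x]dotmxC ![dotmx _ (x + p)]dotmxC.
rewrite -/(qform S _) -/(qform Y _) -/(qform S _) -/(qform Y _).
rewrite [qform S (x + p)]qformD// [qform Y (x + p)]qformD//.
rewrite [dotmx x (a + _)]dotmxDr [dotmx _ (a - _)]dotmxDr dotmxNr !dotmxZr.
rewrite [dotmx (x + p) a]dotmxDl [dotmx (x + p) b]dotmxDl.
rewrite -/(qform S p) -/(qform Y p).
apply/eqP; rewrite -subr_eq0; apply/eqP.
(* The difference of the two sides is a multiple of i^2 + 1. *)
transitivity ((2 * P * qform Y x + P / 2 * V) * (i * i + 1)).
  by field.
by rewrite i2 addNr mulr0.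
Qed.

(** The exponent H is a quadratic form plus terms which are additive or
    constant.  Its polarisation is symmetric, and X is not; the antisymmetric
    part of X cancels the symplectic form in the exponent of the cocycle. *)
Lemma cocycle_exponent p q p' q' :
  - (P / 2) * Hform p q + (P * (dotmx p q' - dotmx p' q) * i +
    (- P * Xform p q p' q' + - (P / 2) * Hform p' q')) =
  - (P / 2) * Hform (p + p') (q + q').
Proof.
have yD : ustar (p + p') (q + q') = ustar p q + ustar p' q'.
  by rewrite /ustar !mulmxDr scalerDr opprD [X in X + (q + q')]addrACA [LHS]addrACA.
have HE x y : Hform x y = qform Y' (ustar x y) - 4 * i * dotmx b (Y' *m ustar x y) +
    4 * (i * i) * qform Y' b + 2 * i * dotmx x (ustar x y) -
    4 * (i * i) * dotmx x b + 4 * i * dotmx x a.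
  rewrite HformE -scaleNr qformD// qformZ -scalemxAr dotmxZr dotmxDr dotmxZr.
  by rewrite [dotmx (ustar x y) _]dotmx_sym//; ring.
have XE : Xform p q p' q' = dotmx (ustar p q) (Y' *m ustar p' q') +
    2 * i * dotmx p (ustar p' q') + 2 * qform Y' b.
  by rewrite /Xform dotmxDl dotmxZl dotmx_mul_inv.
rewrite XE !HE yD [qform Y' (ustar p q + _)]qformD// [Y' *m (_ + _)]mulmxDr.
rewrite [dotmx b (_ + _)]dotmxDr [dotmx (p + p') b]dotmxDl [dotmx (p + p') a]dotmxDl.
rewrite [dotmx (p + p') _]dotmxDl.
rewrite [dotmx p (ustar p q + _)]dotmxDr [dotmx p' (ustar p q + _)]dotmxDr.
rewrite [dotmx p (ustar p' q')]dotmx_ustar [dotmx p' (ustar p q)]dotmx_ustar.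
rewrite [dotmx p' (S *m p)]dotmx_sym// [dotmx p' (Y *m p)]dotmx_sym//.
apply/eqP; rewrite -subr_eq0; apply/eqP.
(* The difference of the two sides is again a multiple of i^2 + 1. *)
transitivity (- (2 * P * qform Y' b) * (i * i + 1)).
  by field.
by rewrite i2 addNr mulr0.
Qed.
End theta_exponent.

(** * The quantum theta function *)

Section theta.
Context (R : realType) (n : nat) (T : 'M[R[i]]_n) (c : 'cV[R[i]]_n).
Hypotheses (T_sym : T^T = T) (ImT_pos : posdefmx (immx T)).
Local Open Scope complex_scope.
Implicit Types (g h k w : phase R n) (x y z : 'cV[R[i]]_n).

Local Notation Y := (cplxmx (immx T)).
Local Notation S := (cplxmx (remx T)).
Local Notation Y' := (im_inv T).
Local Notation a := (cplxmx (remx c)).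
Local Notation b := (cplxmx (immx c)).

Let ImT_sym : (immx T)^T = immx T.
Proof. by rewrite /immx map_trmx T_sym. Qed.

Let S_sym : S^T = S.
Proof. by rewrite /cplxmx /remx !map_trmx T_sym. Qed.

Let Y_sym : Y^T = Y.
Proof. by rewrite /cplxmx map_trmx ImT_sym. Qed.

Let Y'_sym : Y'^T = Y'.
Proof. by rewrite /im_inv /cplxmx map_trmx trmx_inv ImT_sym. Qed.

Lemma posdef_unitmx : immx T \in unitmx.
Proof. by rewrite unitmxE unitfE gt_eqF// posdef_det_gt0. Qed.

Let YinvY : Y *m Y' = 1%:M.
Proof. by rewrite -cplxmxM mulmxV ?posdef_unitmx// /cplxmx map_mx1. Qed.

Local Notation Hf := (Hform 'i S Y Y' a b).
Local Notation us w := (ustar 'i S Y (cplxmx w.1) (cplxmx w.2)).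

Lemma uline_starE w : uline_star T w = us w.
Proof. by rewrite /uline_star conjmx_decomp mulmxBl -scalemxAl. Qed.

Lemma ulineE w : uline T w = us w + (2 * 'i) *: (Y *m cplxmx w.1).
Proof. by rewrite /uline {1}(cplxmx_decomp T) ustar_unstar. Qed.

Lemma HcE w : Hc T c w = Hf (cplxmx w.1) (cplxmx w.2).
Proof. by rewrite /Hc ulineE uline_starE. Qed.

Lemma XghE g k : Xgh T c g k =
  Xform 'i S Y Y' b (cplxmx g.1) (cplxmx g.2) (cplxmx k.1) (cplxmx k.2).
Proof. by rewrite /Xgh ulineE uline_starE. Qed.

Lemma conjc_heis_gaussT w (t : 'cV[R]_n)
    (x := cplxmx t) (p := cplxmx w.1) (q := cplxmx w.2) :
  conjc (heis w (gaussT T c) t) =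
  cexp (- ((2 * pi%:C * dotmx x q + pi%:C * dotmx p q) * 'i) +
    - (pi%:C * 'i * dotmx (x + p) (conjmx T *m (x + p)) +
      2 * pi%:C * 'i * dotmx (conjmx c) (x + p))).
Proof.
rewrite cexpD /heis conjcM !conj_cexp; congr (cexp _ * cexp _).
  rewrite conjcM conjc_real conjc_i mulrN !dotmx_cplx.
  by rewrite rmorphD !rmorphM rmorph_nat.
have two : conjc (2 : R[i]) = 2 by exact: rmorph_nat.
rewrite conjcD !conjcM !conjc_dotmx conjmxM !conjmx_cplx.
rewrite cplxmxD conjc_real conjc_i two.
by rewrite opprD !mulrN !mulNr.
Qed.

(** The complex vector that completes the square in [gauss_exponent]. *)
Definition gauss_shift w := ('i / 2) *: (Y' *m (us w - (2 * 'i) *: b)).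

Lemma gaussT_inner_integrand w t :
  gaussT T c (cvec t) * conjc (heis w (gaussT T c) (cvec t)) =
  Cgc T c w * cexp (- (2 * pi)%:C * qform Y (cplxmx (cvec t) + gauss_shift w)).
Proof.
have e1 : (2 * pi)%:C = 2 * pi%:C :> R[i] by rewrite rmorphM rmorph_nat.
have e2 : (pi / 2)%:C = pi%:C / 2 :> R[i] by rewrite rmorphM fmorphV rmorph_nat.
rewrite conjc_heis_gaussT /Cgc -!cexpD HcE e1 e2; congr cexp.
have E := gauss_exponent (pi%:C) a b (mul_ii R) S_sym Y_sym Y'_sym YinvY
  (cplxmx w.1) (cplxmx w.2) (cplxmx (cvec t)).
rewrite -[RHS]E -(cplxmx_decomp T) -(cplxmx_decomp c).
by rewrite -(conjmx_decomp T) -(conjmx_decomp c).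
Qed.

Lemma inner_gaussT w : inner_L2 (gaussT T c) (heis w (gaussT T c)) =
  ((Num.sqrt (2 ^+ n * \det (immx T)))^-1)%:C * Cgc T c w.
Proof.
have [iF IF] := cintegral_gauss (gauss_shift w) ImT_sym ImT_pos.
rewrite mulrC -IF -(cintegralZl _ iF).
rewrite [LHS](_ : _ = cintegral (lebesgue_tuple R n)
  (fun t => gaussT T c (cvec t) * conjc (heis w (gaussT T c) (cvec t))))//.
by congr cintegral; apply/funext => t; exact: gaussT_inner_integrand.
Qed.

Lemma quantum_thetaE D Theta w : is_quantum_theta T c D Theta -> D w ->
  Theta w = Cgc T c w.
Proof.
move=> ThetaP Dw; have := ThetaP w; rewrite /inner_D mem_set// inner_gaussT.
have detT : 0 < \det (immx T) by exact: posdef_det_gt0.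
have N0 : ((Num.sqrt (2 ^+ n * \det (immx T)))^-1)%:C != 0 :> R[i].
  by rewrite (inj_eq (@complexI R)) invr_eq0 gt_eqF// sqrtr_gt0 mulr_gt0.
by move=> /(mulfI N0)/esym.
Qed.

(** The functional equation of w |-> C_{w,c} on the whole of phase space. *)
Lemma Cgc_cocycle g k :
  Cgc T c g * (cocycle g k * (cexp (- pi%:C * Xgh T c g k) * Cgc T c k)) =
  Cgc T c (g + k).
Proof.
have e2 : (pi / 2)%:C = pi%:C / 2 :> R[i] by rewrite rmorphM fmorphV rmorph_nat.
rewrite /Cgc /cocycle -!cexpD !HcE XghE e2; congr cexp.
have E := cocycle_exponent (pi%:C) a b (mul_ii R) S_sym Y_sym Y'_sym YinvY
  (cplxmx g.1) (cplxmx g.2) (cplxmx k.1) (cplxmx k.2).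
rewrite [cplxmx (g + k).1]cplxmxD [cplxmx (g + k).2]cplxmxD -[RHS]E.
by rewrite !dotmx_cplx rmorphM rmorphB.
Qed.
End theta.

Theorem mainTheorem1 (R : realType) (n : nat) (n_gt0 : (0 < n)%N)
    (T : 'M[R[i]]_n) (T_sym : T^T = T) (ImT_pos : posdefmx (immx T))
    (c : 'cV[R[i]]_n)
    (D : set (phase R n)) (D_discrete : discrete_subgroup D)
    (Theta : phase R n -> R[i]) (Theta_def : is_quantum_theta T c D Theta) :
  forall g, D g -> forall h, D h ->
    Cgc T c g * tconv D (delta g) (qtrans T c g Theta) h = Theta h.
Proof.
move=> g Dg h Dh; have [_ DB _] := D_discrete.
have Dk : D (h - g) by exact: DB.
rewrite tconv_deltal// /qtrans !(quantum_thetaE T_sym ImT_pos Theta_def)//.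
by rewrite (Cgc_cocycle c T_sym ImT_pos g (h - g)) (addrC g) subrK.
Qed.
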